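(* For every monic polynomial $\tilde p \in \mathbb{C}[z]$ of degree $d \geq 3$ with $d$ distinct roots, the Gauss--Seidel variant of the Weierstrass method for $\tilde p$, $\operatorname{GSW}_{\tilde p}\colon \mathbb{C}^d \dashrightarrow \mathbb{C}^d$, has diverging orbits in $\mathbb{C}^d$.
   Context: For a monic polynomial $p$ of degree $n$ the Weierstrass update of the $i$-th coordinate is $$\operatorname{W}_p(z_i; z_1,\dots,\hat{z_i},\dots,z_n) = z_i - \frac{p(z_i)}{\prod_{j\neq i}(z_i-z_j)},$$ where a hat means that the entry is omitted. The Gauss--Seidel variant $\operatorname{GSW}_p \colon \mathbb{C}^n\dashrightarrow\mathbb{C}^n$ is the rational map obtained by starting from $(z_1,\dots,z_n)$ and, successively for $i=1,2,\dots,n$, replacing $z_i$ by $\operatorname{W}_p(z_i;z_1,\dots,\hat{z_i},\dots,z_n)$, where the current (already updated) values of $z_1,\dots,z_{i-1}$ are used; the output is the resulting vector. It is well defined at a point if all the denominators occurring in these $n$ successive updates are nonzero. A diverging orbit in $\mathbb{C}^n$ of a rational map $F\colon\mathbb{C}^n\dashrightarrow\mathbb{C}^n$ is an infinite forward orbit $(x^{j})_{j\ge 0}$ in $\mathbb{C}^n$ such that $F$ is well defined at each $x^j$, $x^{j+1}=F(x^j)$ for all $j$, and $\|x^j\|\to\infty$ as $j\to\infty$. *)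

(* Defs.v *)
From HB Require Import structures.
From mathcomp Require Export all_boot all_order all_algebra.
From mathcomp Require Export all_classical all_reals all_analysis.
From mathcomp Require Export complex.
Export Order.TTheory GRing.Theory Num.Theory.
Export numFieldNormedType.Exports.

Set Implicit Arguments.
Unset Strict Implicit.
Unset Printing Implicit Defensive.

#[export] Set Implicit Arguments.
#[export] Unset Strict Implicit.
#[export] Unset Printing Implicit Defensive.

Local Open Scope classical_set_scope.
Local Open Scope ring_scope.
Local Open Scope complex_scope.

Section GaussSeidelWeierstrass.
Variables (F : fieldType) (d : nat).
Implicit Types (p : {poly F}) (z : 'rV[F]_d) (i : 'I_d).

Definition weierstrass_denom z i : F :=
  \prod_(j < d | j != i) (z ord0 i - z ord0 j).

Definition weierstrass_update p z i : F :=
  z ord0 i - p.[z ord0 i] / weierstrass_denom z i.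

(* A partial map: None encodes that the denominator vanishes. *)
Definition weierstrass_step p z i : option 'rV[F]_d :=
  if weierstrass_denom z i == 0 then None
  else Some (\row_j (if j == i then weierstrass_update p z i else z ord0 j)).

(* [enum 'I_d] lists the coordinates in increasing order, so the coordinates
   are updated in place from the first to the last; the value is None as soon
   as one of the d denominators met along the way vanishes. *)
Definition GSW p z : option 'rV[F]_d :=
  foldl (fun oz i => obind (fun y => weierstrass_step p y i) oz)
    (Some z) (enum 'I_d).

End GaussSeidelWeierstrass.

(* [`|x j|] is the library norm of ['rV[R[i]]_d], i.e. the sup norm; it takes
   its (real) values in [R[i]], and [+oo] is the filter of the sets containing
   a half-line above some real number. *)
Definition diverging_orbit (R : realType) (d : nat)
    (f : 'rV[R[i]]_d -> option 'rV[R[i]]_d) (x : nat -> 'rV[R[i]]_d) : Prop :=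
  (forall j, f (x j) = Some (x j.+1)) /\
  (fun j => `|x j|) @ \oo --> +oo.

(* Main.v *)
Require Import Defs.
From mathcomp Require Import ring lra zify.

(** A coordinate placed at a root of [p] is never moved by a Weierstrass
    update, because the numerator of the correction vanishes there.  So put all
    but two coordinates at distinct roots [gs] of [p], leaving out the roots
    [a] and [b].  In the update of a moving coordinate the factors [u - g],
    [g] in [gs], cancel between [p] and the denominator, and what remains is
    the method for the quadratic polynomial [(X - a)(X - b)] on two coordinates
    ([GSW_quadratic]).

    The quadratic method is solved explicitly.  In the coordinate
    [x = (z - a) / (z - b)], which sends the roots to 0 and infinity and the
    point at infinity to 1, the update of [u] against [v] is the quotient of
    their coordinates ([quadratic_update_moebius]).  The successive new values
    produced by the Gauss-Seidel sweeps therefore form one sequence with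
    [x_(n+2) = x_n / x_(n+1)].  If [g] is the positive root of
    [g ^ 2 = 1 - g], then [x_n = exp (g ^ n)] is such a sequence.  It consists
    of pairwise distinct reals larger than 1 and tends to 1, so the
    corresponding points [z_n] are pairwise distinct and tend to infinity.
    From some index on they are also different from all the roots [gs], so no
    denominator vanishes, and consecutive pairs [(z_(2j), z_(2j+1))] complete
    the frozen roots to a diverging orbit. *)

Local Open Scope classical_set_scope.
Local Open Scope ring_scope.
Local Open Scope complex_scope.

(** * Reduction to a quadratic polynomial *)

Definition row_of_seq (F : fieldType) (m : nat) (s : seq F) : 'rV[F]_m :=
  \row_j s`_j.

(** The Weierstrass update of [u] against [v] for [(X - a)(X - b)]. *)
Definition quadratic_update (F : fieldType) (a b u v : F) : F :=
  u - (u - a) * (u - b) / (u - v).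

Lemma weierstrass_denom_neq0 (F : fieldType) m (s : seq F) (i : 'I_m) :
  uniq s -> size s = m -> weierstrass_denom (row_of_seq m s) i != 0.
Proof.
move=> us ss; apply/prodf_neq0 => j ji.
by rewrite !mxE subr_eq0 nth_uniq ?ss // eq_sym.
Qed.

Section Reduction.
Variables (F : fieldType) (n : nat) (a b : F) (gs : seq F).
Hypothesis gs_size : size gs = n.
Let p : {poly F} := \prod_(r <- [:: a, b & gs]) ('X - r%:P).
Let row := @row_of_seq F n.+2.

Lemma weierstrass_step_root (u v : F) (i : 'I_n) :
  uniq [:: u, v & gs] ->
  weierstrass_step p (row [:: u, v & gs]) (lift ord0 (lift ord0 i)) =
  Some (row [:: u, v & gs]).
Proof.
move=> us; rewrite /weierstrass_step.
rewrite (negPf (weierstrass_denom_neq0 _ us _)) /= ?gs_size //.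
congr Some; apply/rowP => j; rewrite !mxE; case: eqP => // ->.
rewrite /weierstrass_update mxE /=.
have /rootP -> : root p gs`_i.
  by rewrite root_prod_XsubC !inE mem_nth ?orbT // gs_size.
by rewrite mul0r subr0.
Qed.

Lemma weierstrass_update_quadratic (z : 'rV[F]_n.+2) i v :
  weierstrass_denom z i =
    (z ord0 i - v) * \prod_(j < n) (z ord0 i - gs`_j) ->
  weierstrass_denom z i != 0 ->
  weierstrass_update p z i = quadratic_update a b (z ord0 i) v.
Proof.
rewrite /weierstrass_update /quadratic_update => ->.
rewrite mulf_eq0 negb_or => /andP[_ G0].
rewrite /p !big_cons !hornerM !hornerXsubC mulrA horner_prod.
rewrite (big_nth 0) gs_size big_mkord.
under eq_bigr do rewrite hornerXsubC.
by rewrite -mulf_div divff // mulr1.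
Qed.

Lemma weierstrass_step_fst (u v : F) :
  uniq [:: u, v & gs] ->
  weierstrass_step p (row [:: u, v & gs]) ord0 =
  Some (row [:: quadratic_update a b u v, v & gs]).
Proof.
move=> us.
have D0 : weierstrass_denom (row [:: u, v & gs]) ord0 != 0.
  by apply: weierstrass_denom_neq0; rewrite //= gs_size.
rewrite /weierstrass_step (negPf D0).
congr Some; apply/rowP => j; rewrite [LHS]mxE [RHS]mxE.
case: eqP => [->|/eqP]; last by rewrite mxE; case: j => -[|].
rewrite (@weierstrass_update_quadratic _ _ v) ?mxE //.
rewrite /weierstrass_denom big_mkcond !big_ord_recl /= mul1r !mxE /=.
by under eq_bigr do rewrite mxE /=.
Qed.

Lemma weierstrass_step_snd (u v : F) :
  uniq [:: u, v & gs] ->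
  weierstrass_step p (row [:: u, v & gs]) (lift ord0 ord0) =
  Some (row [:: u, quadratic_update a b v u & gs]).
Proof.
move=> us.
have D0 : weierstrass_denom (row [:: u, v & gs]) (lift ord0 ord0) != 0.
  by apply: weierstrass_denom_neq0; rewrite //= gs_size.
rewrite /weierstrass_step (negPf D0).
congr Some; apply/rowP => j; rewrite [LHS]mxE [RHS]mxE.
case: eqP => [->|/eqP]; last by rewrite mxE; case: j => -[|[|]].
rewrite (@weierstrass_update_quadratic _ _ u) ?mxE //.
rewrite /weierstrass_denom big_mkcond !big_ord_recl /= mul1r !mxE /=.
by under eq_bigr do rewrite mxE /=.
Qed.

(** The three distinctness hypotheses are the nonvanishing of the denominators
    before the first update, before the second one, and during the updates of
    the frozen coordinates. *)
Lemma GSW_quadratic (u v : F) :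
  let w := quadratic_update a b u v in
  let w' := quadratic_update a b v w in
  uniq [:: u, v & gs] -> uniq [:: w, v & gs] -> uniq [:: w, w' & gs] ->
  GSW p (row [:: u, v & gs]) = Some (row [:: w, w' & gs]).
Proof.
move=> w w' uv wv ww'.
rewrite /GSW !enum_ordSl /= weierstrass_step_fst //= weierstrass_step_snd //=.
by elim: (enum _) => //= i s IHs; rewrite weierstrass_step_root.
Qed.

End Reduction.

(** * The quadratic method in a multiplicative coordinate *)

Section Moebius.
Variables (F : fieldType) (a b : F).
Hypothesis ab : a != b.

(** The inverse of the coordinate [z |-> (z - a) / (z - b)], that is
    [(b * x - a) / (x - 1)], written so that its behaviour near the pole
    [x = 1] is visible. *)
Definition moebius (x : F) : F := b + (b - a) / (x - 1).

(** Writing [w] for the update of [u] against [v], one has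
    [w - a = (u - a)(b - v) / (u - v)] and [w - b = (u - b)(a - v) / (u - v)],
    so the coordinate of [w] is the quotient of those of [u] and [v]. *)
Lemma quadratic_update_moebius (x y : F) :
  x != 1 -> y != 0 -> y != 1 -> x != y ->
  quadratic_update a b (moebius x) (moebius y) = moebius (x / y).
Proof.
rewrite /quadratic_update /moebius => x1 y0 y1 xy.
have Hx : x - 1 != 0 by rewrite subr_eq0.
have Hy : y - 1 != 0 by rewrite subr_eq0.
have Hxy : x - y != 0 by rewrite subr_eq0.
have Hyx : y - x != 0 by rewrite subr_eq0 eq_sym.
have Hab : b - a != 0 by rewrite subr_eq0 eq_sym.
(* The two composite denominators are factored first: their nonvanishing is
   visible only on the factored form. *)
have -> : x / y - 1 = (x - y) / y by field.
have -> : b + (b - a) / (x - 1) - (b + (b - a) / (y - 1)) =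
  (b - a) * (y - x) / ((x - 1) * (y - 1)) by field; rewrite Hx Hy.
by field; rewrite Hx Hy Hab Hxy Hyx y0.
Qed.

Lemma moebius_inj : injective moebius.
Proof.
move=> x y /addrI /mulfI; rewrite subr_eq0 eq_sym => /(_ ab).
by move=> /invr_inj /addIr.
Qed.

End Moebius.

(** * The multiplicative recurrence *)

Section Golden.
Variable R : realType.

Definition golden : R := (Num.sqrt 5 - 1) / 2.

Lemma golden_itv : 0 < golden < 1.
Proof.
have := @sqr_sqrtr R 5; have := sqrtr_ge0 (5 : R); rewrite /golden.
move: (Num.sqrt 5) => s s0 /(_ ltac:(lra)) s2.
by apply/andP; split; nra.
Qed.

Lemma golden_sqr : golden ^+ 2 = 1 - golden.
Proof.
have := @sqr_sqrtr R 5; rewrite /golden.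
by move: (Num.sqrt 5) => s /(_ ltac:(lra)) s2; nra.
Qed.

Definition golden_exp (n : nat) : R := expR (golden ^+ n).

Lemma golden_exp_gt1 n : 1 < golden_exp n.
Proof. by rewrite expR_gt1 exprn_gt0 //; case/andP: golden_itv. Qed.

(** Taking logarithms, this is [g ^ n - g ^ (n + 1) = g ^ (n + 2)]. *)
Lemma golden_exp_rec n : golden_exp n / golden_exp n.+1 = golden_exp n.+2.
Proof.
rewrite /golden_exp -expRN -expRD; congr expR.
by rewrite -addn2 exprD golden_sqr exprS; ring.
Qed.

Lemma golden_exp_inj : injective golden_exp.
Proof.
case/andP: golden_itv => g0 g1 m n /expR_inj.
by apply: ieexprIn => //; rewrite lt_eqF.
Qed.

Lemma golden_exp_cvg : golden_exp @ \oo --> (1 : R).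
Proof.
rewrite -(@expR0 R); apply: (@cvg_comp _ _ _ (fun n => golden ^+ n) expR).
  by apply: cvg_expr; case/andP: golden_itv => g0 g1; rewrite gtr0_norm.
exact: continuous_expR.
Qed.

End Golden.

(** * The escaping sequence *)

Section Escape.
Variables (R : realType) (a b : R[i]).
Hypothesis ab : a != b.

Definition escaping (n : nat) : R[i] := moebius a b (golden_exp R n)%:C.

Lemma escaping_inj : injective escaping.
Proof. by move=> m n /(moebius_inj ab) /complexI /golden_exp_inj. Qed.

Lemma escaping_rec n :
  quadratic_update a b (escaping n) (escaping n.+1) = escaping n.+2.
Proof.
have x1 m : (golden_exp R m)%:C != 1.
  by rewrite (inj_eq (@complexI R) _ 1) gt_eqF ?golden_exp_gt1.
rewrite /escaping quadratic_update_moebius // -?golden_exp_rec ?fmorph_div //.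
- by rewrite fmorph_eq0 gt_eqF // expR_gt0.
- rewrite (inj_eq (@complexI R)) (inj_eq (@golden_exp_inj R)).
  by rewrite neq_ltn ltnSn.
Qed.

(** The norm of [escaping n] is at least
    [`|b - a| / (golden_exp n - 1) - `|b|], whose denominator tends to 0. *)
Lemma escaping_norm (A : R) : \forall n \near \oo, A%:C < `|escaping n|.
Proof.
have [c bE] : exists c, `|b| = c%:C by apply/complex_realP/normr_real.
have [e eE] : exists e, `|b - a| = e%:C by apply/complex_realP/normr_real.
have e0 : 0 < e by rewrite -ltcR -eE normr_gt0 subr_eq0 eq_sym.
have c0 : 0 <= c by rewrite -lecR -bE normr_ge0.
have M0 : 0 < `|A| + c + 1 by rewrite ltr_wpDl // addr_ge0.
have /cvgrPdist_lt/(_ _ (divr_gt0 e0 M0)) := @golden_exp_cvg R.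
apply: filterS => n; have x1 := golden_exp_gt1 R n.
rewrite distrC gtr0_norm ?subr_gt0 // => xn.
have x0 : 0 < golden_exp R n - 1 by rewrite subr_gt0.
rewrite /escaping /moebius addrC; apply: lt_le_trans (lerB_normD _ _).
rewrite normrM normfV eE bE -(rmorph1 (real_complex R)) -rmorphB.
rewrite (@gtr0_norm _ (_ - _)%:C) ?ltcR // -fmorph_div -rmorphB ltcR.
rewrite ltrBrDr ltr_pdivlMr // mulrC.
move: xn; rewrite ltr_pdivlMr //; apply: le_lt_trans.
by rewrite ler_pM2l //; have := ler_norm A; lra.
Qed.

Lemma escaping_notin (gs : seq R[i]) : \forall n \near \oo, escaping n \notin gs.
Proof.
elim: gs => [|g gs IHgs]; first exact: nearW.
have [c gE] : exists c, `|g| = c%:C by apply/complex_realP/normr_real.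
apply: filterS2 IHgs (escaping_norm c) => n ngs cn.
by rewrite inE negb_or ngs andbT; apply: contraTneq cn => ->; rewrite gE ltxx.
Qed.

End Escape.

(** * Diverging orbits *)

Lemma ler_norm_coord (K : numFieldType) m (z : 'rV[K]_m) i :
  `|z ord0 i| <= `|z|.
Proof.
rewrite [leRHS]/Num.norm /= mx_normE.
have -> : `|z ord0 i| = `|z ord0 i|%:nng%:num by [].
by rewrite num_le; apply/bigmax_geP; right; exists (ord0, i).
Qed.

Theorem theorem2 (R : realType) (d : nat) (p : {poly R[i]}) (rs : seq R[i])
    (hd : (3 <= d)%N) (pmonic : p \is monic) (pdeg : size p = d.+1)
    (rs_uniq : uniq rs) (rs_size : size rs = d) (rs_root : all (root p) rs) :
  exists x : nat -> 'rV[R[i]]_d, diverging_orbit (GSW p) x.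
Proof.
have pE : p = \prod_(r <- rs) ('X - r%:P).
  rewrite {1}(@all_roots_prod_XsubC _ p rs) ?uniq_rootsE ?rs_size //.
  by rewrite (monicP pmonic) scale1r.
case: d rs rs_uniq rs_size hd pE {pdeg rs_root} => [|[|n]] [|a [|b gs]] //=.
rewrite inE negb_or => /and3P[/andP[ab _] _ gs_uniq] [gs_size] _ pE.
have [N _ Ngs] := escaping_notin ab gs.
have pair_uniq i j : (N <= i)%N -> (N <= j)%N -> i != j ->
    uniq [:: escaping a b i, escaping a b j & gs].
  move=> Ni Nj ij; rewrite /= inE negb_or (inj_eq (escaping_inj ab)) ij gs_uniq.
  by rewrite (Ngs i Ni) (Ngs j Nj).
exists (fun j => row_of_seq n.+2
  [:: escaping a b (N + j.*2), escaping a b (N + j.*2).+1 & gs]).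
split=> [j|].
  rewrite pE doubleS !addnS; move: (N + j.*2)%N (leq_addr j.*2 N) => k Nk.
  have := @GSW_quadratic _ _ a b _ gs_size (escaping a b k) (escaping a b k.+1).
  rewrite /= !escaping_rec //; apply; apply: pair_uniq; lia.
move=> P [_ [/complex_realP[A ->] AP]].
have [M _ MA] := escaping_norm ab A.
exists M => //= j Mj; apply: AP.
apply: lt_le_trans (ler_norm_coord _ ord0); rewrite mxE /=.
by apply: MA => /=; rewrite (leq_trans Mj) // -addnn addnA leq_addl.
Qed.
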